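(* Let $M^2$ be a spacelike surface in $\mathbb R^4_1$ free of flat points. Then $M^2$ is a surface of flat normal connection if and only if for each point $p\in M^2$ the ellipse of normal curvature is a line segment, which is not collinear with the mean curvature vector field $H$.
   Context: $\mathbb R^4_1$ is the four-dimensional Minkowski space with metric $\langle\,,\rangle$ of signature $(3,1)$, with a fixed orthonormal basis $e_1,e_2,e_3,e_4$, $e_1^2=e_2^2=e_3^2=1$, $e_4^2=-1$, giving the orientation. A surface $M^2: z=z(u,v)$, $(u,v)\in\mathcal D\subset\mathbb R^2$ (smooth immersion) is spacelike if the induced metric is Riemannian. Put $E=\langle z_u,z_u\rangle$, $F=\langle z_u,z_v\rangle$, $G=\langle z_v,z_v\rangle$, $W=\sqrt{EG-F^2}$. Choose a normal frame field $\{n_1,n_2\}$ with $\langle n_1,n_1\rangle=1$, $\langle n_2,n_2\rangle=-1$, $\langle n_1,n_2\rangle=0$, such that $\{z_u,z_v,n_1,n_2\}$ is positively oriented. Put $c_{11}^k=\langle z_{uu},n_k\rangle$, $c_{12}^k=\langle z_{uv},n_k\rangle$, $c_{22}^k=\langle z_{vv},n_k\rangle$ ($k=1,2$), $$\Delta_1=c_{11}^1c_{12}^2-c_{11}^2c_{12}^1,\quad \Delta_2=c_{11}^1c_{22}^2-c_{11}^2c_{22}^1,\quad \Delta_3=c_{12}^1c_{22}^2-c_{12}^2c_{22}^1,$$ $$L=\frac{2\Delta_1}{W},\quad M=\frac{\Delta_2}{W},\quad N=\frac{2\Delta_3}{W}.$$ A point is flat if $L=M=N=0$ there. $M^2$ has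 flat normal connection if the curvature of its normal connection vanishes identically (in terms of the functions $E,F,G,L,M,N$ this curvature is $\varkappa=\frac{EN+GL-2FM}{2(EG-F^2)}$). $\sigma$ is the (normal-bundle-valued) second fundamental tensor and $H=\frac12(\sigma(x,x)+\sigma(y,y))$ for an orthonormal tangent frame $\{x,y\}$. The ellipse of normal curvature at $p$ is the (possibly degenerate) ellipse $\{\sigma(x,x): x\in T_pM^2,\ \langle x,x\rangle=1\}$ in the normal space at $p$. ''Not collinear with $H$'' means that the direction vector of the segment and $H$ are linearly independent. *)

(* Defs.v *)
From HB Require Import structures.
From mathcomp Require Import all_boot all_order all_algebra.
From mathcomp Require Import all_classical all_reals all_analysis.
Set Implicit Arguments.
Unset Strict Implicit.
Unset Printing Implicit Defensive.
Import Order.TTheory GRing.Theory Num.Theory.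
Import numFieldNormedType.Exports.
Local Open Scope classical_set_scope.
Local Open Scope ring_scope.

(* A surface is given by a map z from 'rV_2 to 'rV_4, only its values on an   *)
(* open set D of parameters (u, v) being relevant; the coordinates of a point *)
(* of 'rV_4 are those with respect to the fixed basis e_1, e_2, e_3, e_4.     *)

Section Calculus.
Variable R : realType.

(* partial 0 f = f_u and partial 1 f = f_v *)
Definition partial (i : 'I_2) (f : 'rV[R]_2 -> 'rV[R]_4) :
  'rV[R]_2 -> 'rV[R]_4 := fun p => 'D_(delta_mx 0 i) f p.

(* C^oo on the open set D: the iterated partial derivatives of all orders     *)
(* exist and are differentiable (hence continuous) at every point of D.       *)
Definition smooth_on (D : set 'rV[R]_2) (f : 'rV[R]_2 -> 'rV[R]_4) : Prop :=
  forall (s : seq 'I_2) (p : 'rV[R]_2),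
    D p -> differentiable (foldr partial f s) p.

Definition mink (x y : 'rV[R]_4) : R :=
  \sum_(i < 4) (-1) ^+ (i == ord_max) * x 0 i * y 0 i.

Definition pos_oriented (a b c d : 'rV[R]_4) : Prop :=
  0 < \det (\matrix_(i < 4) nth 0 [:: a; b; c; d] i).

End Calculus.

Section Surface.
Variables (R : realType) (z : 'rV[R]_2 -> 'rV[R]_4).
Implicit Types (p x y : 'rV[R]_2) (xi n : 'rV[R]_2 -> 'rV[R]_4).

Definition zu := partial 0 z.
Definition zv := partial 1 z.
Definition zuu := partial 0 zu.
Definition zuv := partial 1 zu.
Definition zvv := partial 1 zv.

Definition fE p : R := mink (zu p) (zu p).
Definition fF p : R := mink (zu p) (zv p).
Definition fG p : R := mink (zv p) (zv p).
Definition fW p : R := Num.sqrt (fE p * fG p - fF p ^+ 2).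

(* The row vector x = (x_1, x_2) stands for the tangent vector                *)
(* x_1 z_u + x_2 z_v at p.                                                    *)
Definition tangent p x : 'rV[R]_4 := x 0 0 *: zu p + x 0 1 *: zv p.
Definition metric p x y : R := mink (tangent p x) (tangent p y).

Definition immersion_on (D : set 'rV[R]_2) : Prop :=
  smooth_on D z /\ forall p, D p -> free [:: zu p; zv p].

Definition spacelike_on (D : set 'rV[R]_2) : Prop :=
  forall p, D p -> forall x, x != 0 -> 0 < metric p x x.

(* Orthogonal projection onto the normal space at p of a spacelike surface:   *)
(* the subtracted vector is the tangential component of w, whose coordinates  *)
(* in z_u, z_v are obtained from <w, z_u>, <w, z_v> by inverting the Gram     *)
(* matrix of z_u, z_v.                                                        *)
Definition normal_part p (w : 'rV[R]_4) : 'rV[R]_4 :=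
  w - ((fG p * mink w (zu p) - fF p * mink w (zv p))
         / (fE p * fG p - fF p ^+ 2)) *: zu p
    - ((fE p * mink w (zv p) - fF p * mink w (zu p))
         / (fE p * fG p - fF p ^+ 2)) *: zv p.

Definition normal_frame (D : set 'rV[R]_2) n1 n2 : Prop :=
  [/\ smooth_on D n1, smooth_on D n2 &
   forall p, D p ->
     [/\ mink (n1 p) (zu p) = 0 /\ mink (n1 p) (zv p) = 0,
         mink (n2 p) (zu p) = 0 /\ mink (n2 p) (zv p) = 0,
         [/\ mink (n1 p) (n1 p) = 1, mink (n2 p) (n2 p) = -1 &
             mink (n1 p) (n2 p) = 0] &
         pos_oriented (zu p) (zv p) (n1 p) (n2 p)]].

Definition c11 n p : R := mink (zuu p) (n p).
Definition c12 n p : R := mink (zuv p) (n p).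
Definition c22 n p : R := mink (zvv p) (n p).

Definition Delta1 n1 n2 p : R := c11 n1 p * c12 n2 p - c11 n2 p * c12 n1 p.
Definition Delta2 n1 n2 p : R := c11 n1 p * c22 n2 p - c11 n2 p * c22 n1 p.
Definition Delta3 n1 n2 p : R := c12 n1 p * c22 n2 p - c12 n2 p * c22 n1 p.

Definition fL n1 n2 p : R := 2 * Delta1 n1 n2 p / fW p.
Definition fM n1 n2 p : R := Delta2 n1 n2 p / fW p.
Definition fN n1 n2 p : R := 2 * Delta3 n1 n2 p / fW p.

Definition flat_point n1 n2 p : Prop :=
  [/\ fL n1 n2 p = 0, fM n1 n2 p = 0 & fN n1 n2 p = 0].

Definition normal_section (D : set 'rV[R]_2) xi : Prop :=
  smooth_on D xi /\
  forall p, D p -> mink (xi p) (zu p) = 0 /\ mink (xi p) (zv p) = 0.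

(* Normal covariant derivative of xi along z_u (i = 0) or z_v (i = 1). *)
Definition normal_conn (i : 'I_2) xi : 'rV[R]_2 -> 'rV[R]_4 :=
  fun p => normal_part p (partial i xi p).

(* R(z_u, z_v) xi for the curvature tensor R of the normal connection; there  *)
(* is no bracket term since coordinate fields commute, and R, being           *)
(* skew-symmetric and tensorial, is determined by this component.             *)
Definition normal_curvature xi : 'rV[R]_2 -> 'rV[R]_4 :=
  fun p => normal_conn 0 (normal_conn 1 xi) p
           - normal_conn 1 (normal_conn 0 xi) p.

Definition flat_normal_connection (D : set 'rV[R]_2) : Prop :=
  forall xi, normal_section D xi ->
  forall p, D p -> normal_curvature xi p = 0.

(* Gauss formula: sigma(X, Y) is the normal component of the flat derivative  *)
(* of Y along X, here for X, Y with constant coordinates x, y in z_u, z_v.    *)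
Definition sigma p x y : 'rV[R]_4 :=
  normal_part p
    (\sum_(i < 2) \sum_(j < 2) (x 0 i * y 0 j) *: partial i (partial j z) p).

Definition orthonormal_tangent p x y : Prop :=
  [/\ metric p x x = 1, metric p y y = 1 & metric p x y = 0].

Definition is_mean_curvature p (H : 'rV[R]_4) : Prop :=
  exists x y, orthonormal_tangent p x y /\
    H = 2^-1 *: (sigma p x x + sigma p y y).

Definition curvature_ellipse p : set 'rV[R]_4 :=
  [set sigma p x x | x in [set x | metric p x x = 1]].

End Surface.

Definition line_segment (R : realType) (A B : 'rV[R]_4) : set 'rV[R]_4 :=
  [set (1 - t) *: A + t *: B | t in [set t : R | 0 <= t <= 1]].

(* Main.v *)
Require Import Defs.
From HB Require Import structures.
From mathcomp Require Import all_boot all_order all_algebra.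
From mathcomp Require Import all_classical all_reals all_analysis.
From mathcomp Require Import ring lra.
Set Implicit Arguments.
Unset Strict Implicit.
Unset Printing Implicit Defensive.
Import Order.TTheory GRing.Theory Num.Theory.
Import numFieldNormedType.Exports.
Local Open Scope classical_set_scope.
Local Open Scope ring_scope.

(** The statement is pointwise linear algebra once the normal curvature is
    expressed through the second fundamental form.

    Write X /\ Y ([wedge X Y]) for the determinant, up to sign, of two normal
    vectors in the frame [n1], [n2].  The Ricci equation ([ricci_equation],
    [ricci_frame]) says that the curvature of the normal connection at [p] is
    the operator of the normal plane that exchanges [n1] and [n2], multiplied by
      G * (s11 /\ s12) + E * (s12 /\ s22) - F * (s11 /\ s22)
    ([wedge_trace]), divided by E * G - F ^ 2; here s11, s12, s22 are the second
    derivatives of [z].  Hence the normal connection is flat if and only if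
    [wedge_trace] vanishes at every point ([flat_iff_wedge_trace0]).  The only
    analytic inputs are the product rule and the symmetry of second derivatives
    ([mixed_derivatives]), which is applied both to [z] and to normal fields.

    At a point, let h11, h12, h22 be the second fundamental form in an
    orthonormal tangent frame.  A unit tangent vector of angle t has image
      H + cos (2 t) * a + sin (2 t) * h12,   a = (h11 - h22) / 2,
    under the second fundamental form, so the ellipse of curvature has centre
    the mean curvature vector H and conjugate half-diameters a and h12
    ([curvature_ellipseP]).  Since a /\ h12 is a positive multiple of
    [wedge_trace] ([wedge_axes]), flatness means that a and h12 are multiples of
    one vector d, that is, that the ellipse lies on the line through H directed
    by d.  Then h11 = H + a, h22 = H - a and h12 all lie in the span of H and d;
    if H and d were dependent, or if a = h12 = 0, all the determinants
    h11 /\ h12, h11 /\ h22, h12 /\ h22 would vanish, and the point would be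
    flat ([wedge_center_eq0_flat]).  So away from flat points the segment is not
    reduced to a point and its direction is independent of H
    ([ellipse_segment_criterion]). *)

(** * Symmetry of mixed derivatives *)

Section MixedPartials.
Context {R : realType} {V : normedModType R}.

Lemma is_derive_line (f : V -> R) (df : R) (p v : V) (s : R) :
  is_derive (p + s *: v) v f df ->
  is_derive s 1 (fun t : R => f (p + t *: v)) df.
Proof.
have quotE : (fun h : R => h^-1 *: (f (h *: v + (p + s *: v)) - f (p + s *: v)))
    = (fun h : R => h^-1 *: (f (p + (h *: 1 + s) *: v) - f (p + s *: v))).
  apply/funext => h; congr (_ *: (f _ - _)).
  by rewrite [h *: 1]mulr1 scalerDl addrCA addrA.
move=> [cf vf]; apply: DeriveDef; first by rewrite /derivable /= -quotE.
by rewrite -vf /derive /= -quotE.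
Qed.

(** The mean value theorem, first in the direction [a] for the difference in
    the direction [b], then in the direction [b] for [fa].  The left-hand side
    is symmetric in [a] and [b], which is what makes the two mixed derivatives
    comparable. *)
Lemma second_difference (f fa fab : V -> R) (p a b : V) (h : R) : 0 < h ->
  (forall s t, 0 <= s <= h -> 0 <= t <= h ->
     is_derive (p + s *: a + t *: b) a f (fa (p + s *: a + t *: b)) /\
     is_derive (p + s *: a + t *: b) b fa (fab (p + s *: a + t *: b))) ->
  exists s t, [/\ 0 <= s <= h, 0 <= t <= h &
    f (p + h *: a + h *: b) - f (p + h *: a) - (f (p + h *: b) - f p)
      = fab (p + s *: a + t *: b) * (h * h)].
Proof.
move=> h0 dfh.
have hh : 0 <= h <= h by rewrite (ltW h0) lexx.
have zh : (0 : R) <= 0 <= h by rewrite (ltW h0) lexx.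
pose g s := f (p + h *: b + s *: a) - f (p + s *: a).
have dg s : 0 <= s <= h ->
    is_derive s 1 g (fa (p + s *: a + h *: b) - fa (p + s *: a)).
  move=> sh; apply: is_deriveB.
    apply: is_derive_line; have [+ _] := dfh s h sh hh.
    by rewrite addrAC.
  apply: is_derive_line; have [+ _] := dfh s 0 sh zh.
  by rewrite scale0r addr0.
have [||s sh Es] := MVT (f := g)
  (df := fun s => fa (p + s *: a + h *: b) - fa (p + s *: a)) h0.
- by move=> s /[!in_itv]/= /andP[s0 s1]; apply: dg; rewrite !ltW.
- apply: derivable_within_continuous => s /[!in_itv]/= sh.
  by have [] := dg s sh.
have {}sh : 0 <= s <= h by move: sh; rewrite in_itv/= => /andP[/ltW-> /ltW->].
pose k t := fa (p + s *: a + t *: b).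
have dk t : 0 <= t <= h -> is_derive t 1 k (fab (p + s *: a + t *: b)).
  by move=> th; apply: is_derive_line; have [] := dfh s t sh th.
have [||t th Et] := MVT (df := fun t => fab (p + s *: a + t *: b)) h0 (f := k).
- by move=> t /[!in_itv]/= /andP[t0 t1]; apply: dk; rewrite !ltW.
- apply: derivable_within_continuous => t /[!in_itv]/= th.
  by have [] := dk t th.
exists s, t; split=> //.
  by move: th; rewrite in_itv/= => /andP[/ltW-> /ltW->].
move: Es Et; rewrite /g /k !scale0r !addr0 !subr0 => Es Et.
by rewrite mulrA -Et -Es [p + _ + _]addrAC.
Qed.

(** In an arbitrarily small parallelogram at [p], both mixed derivatives take,
    at some points, the value of the same second difference quotient; by
    continuity they agree at [p].  The derivatives are given as functions
    rather than as iterated [derive], so that the lemma applies to coordinates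
    of vector-valued maps. *)
Lemma mixed_derivatives (f fa fb fab fba : V -> R) (p a b : V) :
  (\forall q \near p, is_derive q a f (fa q)) ->
  (\forall q \near p, is_derive q b f (fb q)) ->
  (\forall q \near p, is_derive q b fa (fab q)) ->
  (\forall q \near p, is_derive q a fb (fba q)) ->
  {for p, continuous fab} -> {for p, continuous fba} ->
  fab p = fba p.
Proof.
move=> dfa dfb dfab dfba cab cba.
apply/eqP; rewrite -subr_eq0 -normr_le0; apply/ler_addgt0Pr => e e0.
rewrite add0r.
have e2 : 0 < e / 2 by rewrite divr_gt0.
have near_ab : \forall q \near p, `|fab p - fab q| < e / 2.
  by move/cvgrPdist_lt: cab; exact.
have near_ba : \forall q \near p, `|fba p - fba q| < e / 2.
  by move/cvgrPdist_lt: cba; exact.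
have : nbhs p (fun q => (is_derive q a f (fa q) /\ is_derive q b f (fb q)) /\
    (is_derive q b fa (fab q) /\ is_derive q a fb (fba q)) /\
    (`|fab p - fab q| < e / 2 /\ `|fba p - fba q| < e / 2)).
  by do !apply: filterI.
move=> /nbhs_normP[r /= r0 ballr].
pose N := `|a| + `|b| + 1.
have N0 : 0 < N by rewrite ltr_wpDl // addr_ge0.
(* With this step the parallelogram spanned by h a and h b is in the ball of
   radius r. *)
pose h := r / N.
have h0 : 0 < h by rewrite divr_gt0.
have inr s t : 0 <= s <= h -> 0 <= t <= h -> `|p - (p + s *: a + t *: b)| < r.
  move=> /andP[s0 sh] /andP[t0 th].
  rewrite -addrA opprD addrA subrr add0r normrN.
  apply: (le_lt_trans (ler_normD _ _)); rewrite !normrZ !ger0_norm //.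
  apply: (@le_lt_trans _ _ (h * `|a| + h * `|b|)).
    by apply: lerD; apply: ler_wpM2r.
  by rewrite -mulrDr -[ltRHS](divfK (lt0r_neq0 N0)) ltr_pM2l // ltrDl.
have [||s [t [sh th Eab]]] := @second_difference f fa fab p a b h.
- by [].
- by move=> s t sh th; have [[? _] [[? _] _]] := ballr _ (inr s t sh th).
have [||t' [s' [th' sh' Eba]]] := @second_difference f fb fba p b a h.
- by [].
- move=> t' s' th' sh'; have [[_ +] [[_ +] _]] := ballr _ (inr s' t' sh' th').
  by rewrite [_ + t' *: b]addrAC.
have h2 : h * h != 0 by rewrite mulf_neq0 // lt0r_neq0.
have E : fab (p + s *: a + t *: b) = fba (p + t' *: b + s' *: a).
  apply: (mulIf h2). rewrite -Eab -Eba [p + h *: b + _]addrAC. ring.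
have [_ [_ [d1 _]]] := ballr _ (inr s t sh th).
have [_ [_ [_ d2]]] := ballr _ (inr s' t' sh' th').
rewrite [_ + t' *: b]addrAC -E in d2.
rewrite -[X in X - _](subrK (fab (p + s *: a + t *: b))) -addrA.
rewrite (le_trans (ler_normD _ _)) // [leRHS]splitr lerD // ltW //.
by rewrite distrC.
Qed.

End MixedPartials.

Section SmoothMaps.
Context {R : realType}.
Implicit Types (D : set 'rV[R]_2) (f g : 'rV[R]_2 -> 'rV[R]_4).

Lemma is_derive_coord n (f : 'rV[R]_2 -> 'rV[R]_n) df p v j :
  is_derive p v f df -> is_derive p v (fun q => f q 0 j) (df 0 j).
Proof.
move=> [cf <-]; apply: DeriveDef; first by move/derivable_mxP: cf; exact.
by rewrite derive_mx // mxE.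
Qed.

Lemma smooth_partial D f i : smooth_on D f -> smooth_on D (partial i f).
Proof. by move=> sf s p Dp; have := sf (rcons s i) p Dp; rewrite foldr_rcons. Qed.

Lemma smooth_is_derive D f i p : smooth_on D f -> D p ->
  is_derive p (delta_mx 0 i) f (partial i f p).
Proof. by move=> sf Dp; apply/derivableP/diff_derivable; apply: (sf [::]). Qed.

Lemma partialC D f i j p : open D -> smooth_on D f -> D p ->
  partial i (partial j f) p = partial j (partial i f) p.
Proof.
move=> oD sf Dp; apply/rowP => k.
have nD : \forall q \near p, D q by apply: open_nbhs_nbhs.
have sfi := smooth_partial i sf; have sfj := smooth_partial j sf.
have ct g : smooth_on D g -> {for p, continuous (fun q => g q 0 k)}.
  move=> sg; apply: (@differentiable_continuous _ _ _ p).
  have dg : differentiable g p by apply: (sg [::]).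
  apply: (@differentiable_comp _ _ _ _ g (fun M => M 0 k)) => //.
  exact: differentiable_coord.
apply: (@mixed_derivatives _ _ (fun q => f q 0 k) (fun q => partial j f q 0 k)
  (fun q => partial i f q 0 k) (fun q => partial i (partial j f) q 0 k)
  (fun q => partial j (partial i f) q 0 k) p (delta_mx 0 j) (delta_mx 0 i));
  [| | | |exact: ct (smooth_partial i sfj)|exact: ct (smooth_partial j sfi)];
  by apply: filterS nD => q Dq; apply: is_derive_coord; apply: smooth_is_derive Dq.
Qed.

End SmoothMaps.

(** * Minkowski product *)

Section Minkowski.
Context {R : realType}.
Implicit Types (x y w : 'rV[R]_4) (k : R).

Lemma minkE x y : mink x y = x 0 0 * y 0 0 + x 0 1 * y 0 1
  + x 0 2%:R * y 0 2%:R - x 0 3%:R * y 0 3%:R.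
Proof.
rewrite /mink !big_ord_recl big_ord0 /= expr1 !expr0 !mul1r mulN1r addr0 mulNr.
rewrite !addrA; do ! [congr (_ * _) | congr (_ + _) | congr (- _)];
  by congr (_ _ _); apply: val_inj.
Qed.

Lemma minkC x y : mink x y = mink y x.
Proof. by rewrite !minkE; ring. Qed.
Lemma minkDl x y w : mink (x + y) w = mink x w + mink y w.
Proof. by rewrite !minkE !mxE; ring. Qed.
Lemma minkNl x w : mink (- x) w = - mink x w.
Proof. by rewrite !minkE !mxE; ring. Qed.
Lemma minkZl k x w : mink (k *: x) w = k * mink x w.
Proof. by rewrite !minkE !mxE; ring. Qed.
Lemma mink0l w : mink 0 w = 0.
Proof. by rewrite !minkE !mxE; ring. Qed.
Lemma minkDr x y w : mink w (x + y) = mink w x + mink w y.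
Proof. by rewrite !minkE !mxE; ring. Qed.
Lemma minkZr k x w : mink w (k *: x) = k * mink w x.
Proof. by rewrite !minkE !mxE; ring. Qed.

Definition minkL := (minkDl, minkNl, minkZl).

(** If [B] is the matrix with rows [a], [b], [c], [d], the four products are the
    entries of [B] applied to [w] with its last coordinate negated. *)
Lemma mink_nondegenerate a b c d w : pos_oriented a b c d ->
  mink w a = 0 -> mink w b = 0 -> mink w c = 0 -> mink w d = 0 -> w = 0.
Proof.
rewrite /pos_oriented; set B := \matrix_(i < 4) _ => detB wa wb wc wd.
pose w' : 'cV[R]_4 := \col_j ((-1) ^+ (j == ord_max) * w 0 j).
have uB : B \in unitmx by rewrite unitmxE unitfE lt0r_neq0.
have Bw : B *m w' = 0.
  apply/colP => i; rewrite !mxE.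
  have -> : \sum_j B i j * w' j 0 = mink w (row i B).
    by apply: eq_bigr => j _; rewrite !mxE mulrC.
  rewrite rowK; case: i => [[|[|[|[|//]]]] ?] //=.
have w'0 : w' = 0 by rewrite -[w'](mulKmx uB) Bw mulmx0.
apply/rowP => j; rewrite mxE; have /colP/(_ j)/eqP := w'0.
by rewrite !mxE mulrI_eq0 ?signr_eq0 => [/eqP//|]; apply/lregP; rewrite signr_eq0.
Qed.

Lemma is_derive_mink (f g : 'rV[R]_2 -> 'rV[R]_4) p v df dg :
  is_derive p v f df -> is_derive p v g dg ->
  is_derive p v (fun q => mink (f q) (g q)) (mink df (g p) + mink (f p) dg).
Proof.
move=> Df Dg.
have -> : (fun q => mink (f q) (g q)) = \sum_(i < 4)
    ((-1) ^+ (i == ord_max) *: ((fun q => f q 0 i) * (fun q => g q 0 i))).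
  apply/funext => q; rewrite /mink fct_sumE; apply: eq_bigr => i _.
  by rewrite -mulrA.
have -> : mink df (g p) + mink (f p) dg = \sum_(i < 4)
    ((-1) ^+ (i == ord_max) *: (f p 0 i *: dg 0 i + g p 0 i *: df 0 i)).
  rewrite /mink -big_split; apply: eq_bigr => i _ /=.
  by rewrite /GRing.scale /=; ring.
apply: is_derive_sum => i; apply: is_deriveZ.
by apply: is_deriveM; apply: is_derive_coord.
Qed.

Lemma is_derive_scale (k : 'rV[R]_2 -> R) (f : 'rV[R]_2 -> 'rV[R]_4) p v dk df :
  is_derive p v k dk -> is_derive p v f df ->
  is_derive p v (fun q => k q *: f q) (dk *: f p + k p *: df).
Proof.
move=> Dk Df.
have Dc i j : is_derive p v (fun q => (k q *: f q) i j)
    ((dk *: f p + k p *: df) i j).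
  have -> : (fun q => (k q *: f q) i j) = k * (fun q => f q 0 j).
    by apply/funext => q; rewrite mxE (ord1 i).
  have -> : (dk *: f p + k p *: df) i j = k p *: df 0 j + f p 0 j *: dk.
    by rewrite !mxE (ord1 i) /GRing.scale /=; ring.
  by apply: is_deriveM; apply: is_derive_coord.
have cv : derivable (fun q => k q *: f q) p v.
  by apply/derivable_mxP => i j; have [] := Dc i j.
by apply: DeriveDef; rewrite // derive_mx //; apply/matrixP => i j;
  rewrite mxE; have [_ ->] := Dc i j.
Qed.

End Minkowski.

(** * Degenerate ellipses *)

Section DegenerateEllipse.
Context {R : realType}.
Implicit Types (A B X Y : 'rV[R]_4) (a b c s : R).

(** The angle-doubling map of the unit circle is onto. *)
Lemma half_angle c s : c ^+ 2 + s ^+ 2 = 1 ->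
  exists a b, [/\ a ^+ 2 + b ^+ 2 = 1, a ^+ 2 - b ^+ 2 = c & 2 * a * b = s].
Proof.
move=> cs1; have [c1|c1] := eqVneq c (-1).
  exists 0, 1; rewrite c1 in cs1 *.
  have /eqP : s ^+ 2 = 0 by move: cs1; rewrite sqrrN expr1n; lra.
  by rewrite sqrf_eq0 => /eqP ->; split; ring.
have c1' : 0 < (1 + c) / 2.
  rewrite divr_gt0 //; have : -1 <= c by have := sqr_ge0 s; nra.
  by rewrite le_eqVlt eq_sym (negbTE c1) /=; lra.
set a := Num.sqrt ((1 + c) / 2).
have a0 : a != 0 by rewrite lt0r_neq0 // sqrtr_gt0.
have aa : a ^+ 2 = (1 + c) / 2 by rewrite sqr_sqrtr // ltW.
exists a, (s / (2 * a)).
have bb : (s / (2 * a)) ^+ 2 = (1 - c) / 2.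
  have ss : s ^+ 2 = 1 - c ^+ 2 by rewrite -cs1; ring.
  rewrite expr_div_n exprMn aa ss; field.
  by apply: contraNneq c1 => c10; apply/eqP; lra.
by rewrite aa bb; split; field.
Qed.

(** An ellipse with parallel half-diameters [a *: d] and [b *: d] is a segment:
    by the Cauchy-Schwarz inequality c * a + s * b runs through [-r, r] on the
    unit circle. *)
Lemma collinear_segment (H d : 'rV[R]_4) a b :
  let r := Num.sqrt (a ^+ 2 + b ^+ 2) in 0 < r ->
  forall X, line_segment (H - r *: d) (H + r *: d) X <->
  exists c s, c ^+ 2 + s ^+ 2 = 1 /\ X = H + (c *: (a *: d) + s *: (b *: d)).
Proof.
move=> r r0 X.
have rr : r ^+ 2 = a ^+ 2 + b ^+ 2 by rewrite sqr_sqrtr // addr_ge0 ?sqr_ge0.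
have r0' : r != 0 by rewrite lt0r_neq0.
have aE c s : H + (c *: (a *: d) + s *: (b *: d)) = H + (c * a + s * b) *: d.
  by rewrite !scalerA -scalerDl.
split=> [[t /= /andP[t0 t1] <-]|[c [s [cs ->]]]].
  pose u := 2 * t - 1; pose v := Num.sqrt (1 - u ^+ 2).
  have vv : v ^+ 2 = 1 - u ^+ 2 by rewrite sqr_sqrtr // /u; nra.
  (* The unit vector whose component along (a, b) / r is u. *)
  exists ((u * a - v * b) / r), ((u * b + v * a) / r); split.
    rewrite !expr_div_n -mulrDl.
    have -> : (u * a - v * b) ^+ 2 + (u * b + v * a) ^+ 2
      = (u ^+ 2 + v ^+ 2) * r ^+ 2 by rewrite rr; ring.
    by rewrite vv addrC subrK mul1r divff // expf_neq0.
  rewrite aE.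
  have -> : (u * a - v * b) / r * a + (u * b + v * a) / r * b = u * r.
    by rewrite -[RHS](mulfK r0') -[u * r * r]mulrA -expr2 rr; field.
  by apply/rowP => j; rewrite !mxE /u; ring.
have le_r : (c * a + s * b) ^+ 2 <= r ^+ 2.
  rewrite rr -subr_ge0 -[X in X - _]mul1r -cs.
  suff -> : (c ^+ 2 + s ^+ 2) * (a ^+ 2 + b ^+ 2) - (c * a + s * b) ^+ 2
    = (c * b - s * a) ^+ 2 by rewrite sqr_ge0.
  by ring.
have {le_r} : `|c * a + s * b| <= r.
  by rewrite -(ger0_norm (ltW r0)) -ler_sqr ?nnegrE // !real_normK ?num_real.
rewrite ler_norml aE; move: (c * a + s * b) => q /andP[q1 q2].
exists ((q / r + 1) / 2) => /=.
  have q1' : - 1 <= q / r by rewrite ler_pdivlMr // mulN1r.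
  have q2' : q / r <= 1 by rewrite ler_pdivrMr // mul1r.
  by apply/andP; split; lra.
by apply/rowP => j; rewrite !mxE; field.
Qed.

Lemma segment_chord A B X Y : line_segment A B X -> line_segment A B Y ->
  exists t, X - Y = t *: (B - A).
Proof.
move=> [t _ <-] [t' _ <-]; exists (t - t').
by apply/rowP => j; rewrite !mxE; ring.
Qed.

End DegenerateEllipse.

(** * The ellipse of curvature at a point *)

Section CurvatureEllipse.
Context {R : realType} (tu tv s11 s12 s22 n1 n2 : 'rV[R]_4).
Implicit Types (x y : 'rV[R]_2) (w X Y n : 'rV[R]_4) (a b c k s : R).

Let E := mink tu tu.
Let F := mink tu tv.
Let G := mink tv tv.

Definition gram := mink tu tu * mink tv tv - mink tu tv ^+ 2.

Definition normal_to w := mink w tu = 0 /\ mink w tv = 0.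

Definition normal_proj w :=
  w - ((G * mink w tu - F * mink w tv) / gram) *: tu
    - ((E * mink w tv - F * mink w tu) / gram) *: tv.

Definition first_form x y :=
  mink (x 0 0 *: tu + x 0 1 *: tv) (y 0 0 *: tu + y 0 1 *: tv).

Definition second_form x y := normal_proj
  ((x 0 0 * y 0 0) *: s11 + (x 0 0 * y 0 1 + x 0 1 * y 0 0) *: s12
     + (x 0 1 * y 0 1) *: s22).

(** Up to sign, the area form of the normal plane, extended to all vectors by
    orthogonal projection, so that it applies directly to second derivatives. *)
Definition wedge X Y := mink X n1 * mink Y n2 - mink X n2 * mink Y n1.

(** Up to a positive power of E * G - F ^ 2, this is the curvature of the normal
    connection. *)
Definition wedge_trace :=
  G * wedge s11 s12 + E * wedge s12 s22 - F * wedge s11 s22.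

Context (E_gt0 : 0 < E) (gram_gt0 : 0 < gram).
Context (n1_normal : normal_to n1) (n2_normal : normal_to n2).
Context (n11 : mink n1 n1 = 1) (n22 : mink n2 n2 = -1) (n12 : mink n1 n2 = 0).
Context (n_oriented : pos_oriented tu tv n1 n2).

Lemma normal_eq X Y : normal_to X -> normal_to Y ->
  mink X n1 = mink Y n1 -> mink X n2 = mink Y n2 -> X = Y.
Proof.
move=> [Xu Xv] [Yu Yv] X1 X2.
apply/eqP; rewrite -subr_eq0; apply/eqP; apply: (mink_nondegenerate n_oriented);
  by rewrite !minkL ?Xu ?Xv ?X1 ?X2 ?Yu ?Yv subrr.
Qed.

Lemma normal_toD X Y : normal_to X -> normal_to Y -> normal_to (X + Y).
Proof. by move=> [Xu Xv] [Yu Yv]; split; rewrite minkDl ?Xu ?Xv ?Yu ?Yv addr0. Qed.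

Lemma normal_toZ k X : normal_to X -> normal_to (k *: X).
Proof. by move=> [Xu Xv]; split; rewrite minkZl ?Xu ?Xv mulr0. Qed.

Lemma normal_projP w : normal_to (normal_proj w).
Proof.
have g0 : E * G - F ^+ 2 != 0 by rewrite lt0r_neq0.
split; rewrite /normal_proj /gram !minkL -/E -/F -/G.
  by rewrite (minkC tv tu) -/F; field.
by field.
Qed.

Lemma mink_normal_proj w n : normal_to n -> mink (normal_proj w) n = mink w n.
Proof.
move=> [nu nv].
by rewrite /normal_proj !minkL (minkC tu) (minkC tv) nu nv !mulr0 !oppr0 !addr0.
Qed.

(** A normal vector is its own projection on the Lorentz frame, where [n2] is
    timelike. *)
Lemma frame_expansion X w : normal_to X ->
  mink X w = mink X n1 * mink w n1 - mink X n2 * mink w n2.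
Proof.
move=> nX; rewrite {1}(_ : X = mink X n1 *: n1 + (- mink X n2) *: n2).
  by rewrite !minkL ![mink _ w]minkC mulNr.
apply: normal_eq => //.
- by apply: normal_toD; apply: normal_toZ.
- by rewrite !minkL n11 (minkC n2) n12; ring.
- by rewrite !minkL n22 n12; ring.
Qed.

Lemma wedgeZl k X Z : wedge (k *: X) Z = k * wedge X Z.
Proof. by rewrite /wedge !minkZl; ring. Qed.
Lemma wedgeZr k X Z : wedge X (k *: Z) = k * wedge X Z.
Proof. by rewrite /wedge !minkZl; ring. Qed.

Lemma wedge_free X Y : wedge X Y != 0 -> free [:: X; Y].
Proof.
move=> XY; rewrite free_cons span_seq1 seq1_free; apply/andP; split.
  by apply: contraNN XY => /vlineP[k ->]; rewrite /wedge !minkZl; apply/eqP; ring.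
by apply: contraNN XY => /eqP ->; rewrite /wedge !mink0l !mulr0 subrr.
Qed.

Lemma wedge_eq0 X Y : normal_to X -> normal_to Y -> X != 0 -> wedge X Y = 0 ->
  exists k, Y = k *: X.
Proof.
move=> nX nY X0 /eqP; rewrite /wedge subr_eq0 => /eqP XY.
have nkX k : normal_to (k *: X) by exact: normal_toZ.
have [X1|X1] := eqVneq (mink X n1) 0; last first.
  exists (mink Y n1 / mink X n1); apply: normal_eq => //; rewrite minkZl.
    by rewrite divfK.
  by rewrite mulrAC [_ * mink X n2]mulrC -XY mulrAC divff // mul1r.
have [X2|X2] := eqVneq (mink X n2) 0.
  case/eqP: X0; apply: normal_eq; rewrite ?mink0l //.
  by split; rewrite mink0l.
exists (mink Y n2 / mink X n2); apply: normal_eq => //; rewrite minkZl.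
  by rewrite mulrAC [_ * mink X n1]mulrC XY mulrAC divff // mul1r.
by rewrite divfK.
Qed.

Lemma first_formE x y : first_form x y = x 0 0 * y 0 0 * E
  + (x 0 0 * y 0 1 + x 0 1 * y 0 0) * F + x 0 1 * y 0 1 * G.
Proof.
rewrite /first_form /E /F /G !minkL !minkDr !minkZr (minkC tv tu); ring.
Qed.

Lemma second_form_normal x y : normal_to (second_form x y).
Proof. exact: normal_projP. Qed.

Lemma mink_second_form x y n : normal_to n ->
  mink (second_form x y) n = x 0 0 * y 0 0 * mink s11 n
  + (x 0 0 * y 0 1 + x 0 1 * y 0 0) * mink s12 n + x 0 1 * y 0 1 * mink s22 n.
Proof. by move=> nn; rewrite mink_normal_proj // !minkL. Qed.

Definition row2 a b : 'rV[R]_2 := \row_j (if j == 0 then a else b).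

Lemma row2E a b : (row2 a b 0 0 = a) * (row2 a b 0 1 = b).
Proof. by rewrite !mxE. Qed.

Let e := Num.sqrt E.
Let W := Num.sqrt gram.

(** The coordinates of the orthonormal tangent frame obtained from [tu], [tv] by
    the Gram-Schmidt process. *)
Definition gs1 := row2 e^-1 0.
Definition gs2 := row2 (- (F / (e * W))) (e / W).

Let e0 : e != 0. Proof. by rewrite lt0r_neq0 // sqrtr_gt0. Qed.
Let W0 : W != 0. Proof. by rewrite lt0r_neq0 // sqrtr_gt0. Qed.
Let EE : E = e ^+ 2. Proof. by rewrite sqr_sqrtr // ltW. Qed.
Let GE : G = (F ^+ 2 + W ^+ 2) / e ^+ 2.
Proof.
rewrite sqr_sqrtr ?ltW // -EE /gram -/E -/F -/G addrC subrK mulrAC divff ?mul1r //.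
exact: lt0r_neq0.
Qed.

Lemma gs_orthonormal : [/\ first_form gs1 gs1 = 1, first_form gs2 gs2 = 1 &
  first_form gs1 gs2 = 0].
Proof.
split; rewrite first_formE !row2E GE EE; field; by rewrite ?e0 ?W0.
Qed.

Let h11 := second_form gs1 gs1.
Let h12 := second_form gs1 gs2.
Let h22 := second_form gs2 gs2.

(** In each of the next three lemmas, the change of basis from [tu], [tv] to the
    orthonormal frame gives the determinant of two values of the second form;
    [2 * F] and [F ^+ 2] come from expanding the square of [gs2]. *)
Lemma wedge_gs11_12 : wedge h11 h12 = wedge s11 s12 / (E * W).
Proof.
rewrite /wedge !mink_second_form // !row2E EE; field; by rewrite e0 W0.
Qed.

Lemma wedge_gs11_22 : wedge h11 h22 =
  (E * wedge s11 s22 - 2 * F * wedge s11 s12) / (E * gram).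
Proof.
rewrite /wedge !mink_second_form // !row2E -(@sqr_sqrtr _ gram) ?ltW // -/W EE.
by field; rewrite e0 W0.
Qed.

Lemma wedge_gs12_22 : wedge h12 h22 =
  (F ^+ 2 * wedge s11 s12 - F * E * wedge s11 s22 + E ^+ 2 * wedge s12 s22)
  / (E * W ^+ 3).
Proof.
rewrite /wedge !mink_second_form // !row2E EE.
by field; rewrite e0 W0.
Qed.

Definition ell_center := 2^-1 *: (h11 + h22).
Definition ell_axis := 2^-1 *: (h11 - h22).

Lemma ell_axis_normal : normal_to ell_axis.
Proof.
apply/normal_toZ/normal_toD; first exact: second_form_normal.
by rewrite -scaleN1r; apply/normal_toZ/second_form_normal.
Qed.

(** In an orthonormal frame E = G = 1 and F = 0, and the trace is
    h11 /\ h12 + h12 /\ h22 = (h11 - h22) /\ h12. *)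
Lemma wedge_axes : wedge ell_axis h12 = wedge_trace / (2 * W ^+ 3).
Proof.
have -> : wedge ell_axis h12 = 2^-1 * (wedge h11 h12 + wedge h12 h22).
  by rewrite /ell_axis; move: h11 h12 h22 => X Y Z; rewrite /wedge !minkL; ring.
rewrite wedge_gs11_12 wedge_gs12_22 /wedge_trace GE EE; field; by rewrite e0 W0.
Qed.

(** The vector [x] is [a *: gs1 + b *: gs2]; for a = cos t and b = sin t the
    coefficients on the right are cos (2 t) and sin (2 t). *)
Lemma second_form_gs a b : a ^+ 2 + b ^+ 2 = 1 ->
  let x := row2 (a / e - b * F / (e * W)) (b * e / W) in
  second_form x x =
    ell_center + ((a ^+ 2 - b ^+ 2) *: ell_axis + (2 * a * b) *: h12).
Proof.
move=> ab1 x.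
have -> : ell_center + ((a ^+ 2 - b ^+ 2) *: ell_axis + (2 * a * b) *: h12)
    = a ^+ 2 *: h11 + ((2 * a * b) *: h12 + b ^+ 2 *: h22).
  have a2 : a ^+ 2 = 1 - b ^+ 2 by rewrite -ab1 addrK.
  rewrite /ell_center /ell_axis; move: h11 h12 h22 => X Y Z.
  by apply/rowP => j; rewrite !mxE a2; field.
have nh n : normal_to n -> mink (second_form x x) n
    = mink (a ^+ 2 *: h11 + ((2 * a * b) *: h12 + b ^+ 2 *: h22)) n.
  move=> nn; rewrite (mink_second_form _ _ nn) minkDl (minkDl (_ *: h12)) !minkZl.
  rewrite !mink_second_form // !row2E.
  by field; rewrite e0 W0.
have nf y y' := second_form_normal y y'.
apply: normal_eq; [exact: nf | | exact: nh | exact: nh].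
exact: normal_toD (normal_toZ _ (nf _ _))
  (normal_toD (normal_toZ _ (nf _ _)) (normal_toZ _ (nf _ _))).
Qed.

Lemma curvature_ellipseP X :
  (exists2 x, first_form x x = 1 & second_form x x = X) <->
  (exists c s, c ^+ 2 + s ^+ 2 = 1 /\ X = ell_center + (c *: ell_axis + s *: h12)).
Proof.
split=> [[x x1 <-]|[c [s [cs ->]]]].
  (* The coordinates of x in the orthonormal frame. *)
  pose a := e * x 0 0 + F / e * x 0 1; pose b := W / e * x 0 1.
  have ab1 : a ^+ 2 + b ^+ 2 = 1.
    by rewrite -x1 first_formE GE EE /a /b; field.
  exists (a ^+ 2 - b ^+ 2), (2 * a * b); split.
    have -> : (a ^+ 2 - b ^+ 2) ^+ 2 + (2 * a * b) ^+ 2 = (a ^+ 2 + b ^+ 2) ^+ 2.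
      by ring.
    by rewrite ab1 expr1n.
  rewrite -second_form_gs //.
  suff -> : row2 (a / e - b * F / (e * W)) (b * e / W) = x by [].
  apply/rowP => j; rewrite mxE; have [->|j1] : j = 0 \/ j = 1.
  - by case: j => [[|[|//]]] ?; [left | right]; apply: val_inj.
  - by rewrite /= /a /b; field; rewrite e0 W0.
  - by rewrite j1 /= /a /b; field; rewrite e0 W0.
have [a [b [ab1 <- <-]]] := half_angle cs.
exists (row2 (a / e - b * F / (e * W)) (b * e / W)).
  by rewrite first_formE !row2E -ab1 GE EE; field; rewrite e0 W0.
exact: second_form_gs.
Qed.

(** Under these hypotheses the three values of the second form in the
    orthonormal frame are in the span of [ell_center] and [d], so that their
    determinants vanish with [wedge d ell_center]; changing basis back to
    [tu], [tv] gives the conclusion, which is the flatness of the point. *)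
Lemma wedge_center_eq0_flat (d : 'rV[R]_4) a b :
  ell_axis = a *: d -> h12 = b *: d -> wedge d ell_center = 0 ->
  [/\ wedge s11 s12 = 0, wedge s11 s22 = 0 & wedge s12 s22 = 0].
Proof.
move=> ad bd dC.
have h11E : h11 = ell_center + ell_axis.
  rewrite /ell_center /ell_axis; move: h11 h22 => X Y.
  by apply/rowP => j; rewrite !mxE; field.
have h22E : h22 = ell_center - ell_axis.
  rewrite /ell_center /ell_axis; move: h11 h22 => X Y.
  by apply/rowP => j; rewrite !mxE; field.
have w0 k l k' l' :
  wedge (k *: ell_center + l *: d) (k' *: ell_center + l' *: d) = 0.
  have -> : wedge (k *: ell_center + l *: d) (k' *: ell_center + l' *: d)
      = (l * k' - k * l') * wedge d ell_center.
    by move: ell_center => C; rewrite /wedge !minkL; ring.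
  by rewrite dC mulr0.
have h11E' : h11 = 1 *: ell_center + a *: d by rewrite scale1r h11E ad.
have h22E' : h22 = 1 *: ell_center + (- a) *: d by rewrite scale1r h22E ad scaleNr.
have h12E' : h12 = 0 *: ell_center + b *: d by rewrite scale0r add0r.
have EW0 : E * W != 0 by rewrite mulf_neq0 // lt0r_neq0.
have Eg0 : E * gram != 0 by rewrite mulf_neq0 // lt0r_neq0.
have EW30 : E * W ^+ 3 != 0 by rewrite mulf_neq0 ?expf_neq0 // lt0r_neq0.
have En0 : E != 0 by rewrite lt0r_neq0.
have := wedge_gs11_12; rewrite h11E' h12E' w0 => /esym/eqP.
rewrite mulf_eq0 invr_eq0 (negbTE EW0) orbF => /eqP D1.
have := wedge_gs11_22; rewrite h11E' h22E' w0 => /esym/eqP.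
rewrite mulf_eq0 invr_eq0 (negbTE Eg0) orbF D1 mulr0 subr0.
rewrite mulf_eq0 (negbTE En0) /= => /eqP D2.
have := wedge_gs12_22; rewrite h12E' h22E' w0 => /esym/eqP.
rewrite mulf_eq0 invr_eq0 (negbTE EW30) orbF D1 D2 !mulr0 subr0 add0r.
by rewrite mulf_eq0 expf_eq0 (negbTE En0) andbF /= => /eqP D3.
Qed.

(** If the ellipse is a segment, its diameters, of directions [ell_axis] and
    [h12], are parallel.  Conversely [wedge_trace = 0] makes them parallel, and
    non-flatness provides both that they do not vanish together and that their
    common direction is independent of the centre. *)
Lemma ellipse_segment_criterion :
  ~ [/\ wedge s11 s12 = 0, wedge s11 s22 = 0 & wedge s12 s22 = 0] ->
  wedge_trace = 0 <->
  exists A B H : 'rV[R]_4,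
  [/\ A != B,
      [set second_form x x | x in [set x | first_form x x = 1]]
        = line_segment A B,
      exists x y, [/\ first_form x x = 1, first_form y y = 1 &
        first_form x y = 0] /\ H = 2^-1 *: (second_form x x + second_form y y) &
      free [:: B - A; H]].
Proof.
move=> not_flat.
have W30 : 2 * W ^+ 3 != 0 by rewrite mulf_neq0 ?expf_neq0.
have -> : wedge_trace = 0 <-> wedge ell_axis h12 = 0.
  rewrite wedge_axes; split=> [->|/eqP]; first by rewrite mul0r.
  by rewrite mulf_eq0 invr_eq0 (negbTE W30) orbF => /eqP.
split=> [axes0|[A [B [H [_ ellAB _ _]]]]]; last first.
  have on_seg c s : c ^+ 2 + s ^+ 2 = 1 ->
      line_segment A B (ell_center + (c *: ell_axis + s *: h12)).
    by move=> cs; rewrite -ellAB; apply/curvature_ellipseP; exists c, s.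
  have [] := @segment_chord _ A B _ _ (on_seg 1 0 _) (on_seg (-1) 0 _);
    [ring | ring | move=> t tE].
  have [] := @segment_chord _ A B _ _ (on_seg 0 1 _) (on_seg 0 (-1) _);
    [ring | ring | move=> t' t'E].
  have -> : ell_axis = (2^-1 * t) *: (B - A).
    rewrite -scalerA -tE; move: ell_center ell_axis h12 => C X Y.
    by apply/rowP => j; rewrite !mxE; field.
  have -> : h12 = (2^-1 * t') *: (B - A).
    rewrite -scalerA -t'E; move: ell_center ell_axis h12 => C X Y.
    by apply/rowP => j; rewrite !mxE; field.
  by rewrite wedgeZl wedgeZr /wedge; ring.
have [d [a [b [ad bd ab0]]]] : exists d a b,
    [/\ ell_axis = a *: d, h12 = b *: d & 0 < a ^+ 2 + b ^+ 2].
  have [axis0|axis0] := eqVneq ell_axis 0; last first.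
    have [] := wedge_eq0 _ _ axis0 axes0; first exact: ell_axis_normal.
      exact: second_form_normal.
    move=> k ->; exists ell_axis, 1, k; rewrite scale1r; split=> //.
    by rewrite ltr_wpDr ?sqr_ge0 // expr1n.
  by exists h12, 0, 1; rewrite scale0r scale1r.
pose r := Num.sqrt (a ^+ 2 + b ^+ 2).
have r0 : 0 < r by rewrite sqrtr_gt0.
have dC : wedge d ell_center != 0.
  by apply/eqP => /(wedge_center_eq0_flat ad bd).
have BA : ell_center + r *: d - (ell_center - r *: d) = (2 * r) *: d.
  by move: ell_center => C; apply/rowP => j; rewrite !mxE; ring.
have fBA : free [:: ell_center + r *: d - (ell_center - r *: d); ell_center].
  by rewrite BA wedge_free // wedgeZl !mulf_neq0 // lt0r_neq0.
exists (ell_center - r *: d), (ell_center + r *: d), ell_center; split=> //.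
- apply: contraTneq fBA => ->; rewrite subrr.
  by rewrite free_cons mem0v.
- apply/seteqP; split=> X; rewrite (collinear_segment _ _ r0) -ad -bd;
    by move/curvature_ellipseP.
- by exists gs1, gs2; split; first exact: gs_orthonormal.
Qed.

End CurvatureEllipse.

(** * The curvature of the normal connection *)

Section RicciEquation.
Context {R : realType} (D : set 'rV[R]_2) (tu tv : 'rV[R]_2 -> 'rV[R]_4).
Implicit Types (xi : 'rV[R]_2 -> 'rV[R]_4) (p : 'rV[R]_2) (i j : 'I_2).

Definition conn i xi : 'rV[R]_2 -> 'rV[R]_4 :=
  fun q => normal_proj (tu q) (tv q) (partial i xi q).

Context (D_open : open D) (tu_smooth : smooth_on D tu)
  (tv_smooth : smooth_on D tv).
Context (gram_gt0 : forall q, D q -> 0 < gram (tu q) (tv q)).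
Context (tuvC : forall q, D q -> partial 0 tv q = partial 1 tu q).

(** Differentiating <xi, t> = 0 moves the derivative from [xi] to [t]; openness
    of [D] is what makes the identity differentiable at [p]. *)
Lemma mink_partial_normal xi (t : 'rV[R]_2 -> 'rV[R]_4) i p :
  smooth_on D xi -> smooth_on D t -> (forall q, D q -> mink (xi q) (t q) = 0) ->
  D p -> mink (partial i xi p) (t p) = - mink (xi p) (partial i t p).
Proof.
move=> xi_s t_s xit Dp; apply/eqP; rewrite -addr_eq0; apply/eqP.
have [_ <-] := is_derive_mink (smooth_is_derive i xi_s Dp)
  (smooth_is_derive i t_s Dp).
rewrite (@near_eq_derive _ _ _ _ (cst 0)) ?derive_cst //.
have : \forall q \near p, D q by apply: open_nbhs_nbhs.
by apply: filterS => q /xit.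
Qed.

(** [coef_u] and [coef_v] are the tangential coordinates of [partial j xi], the
    part removed by the projection in [conn j xi]. *)
Definition coef_u xi j p := (mink (tv p) (tv p) * mink (partial j xi p) (tu p)
  - mink (tu p) (tv p) * mink (partial j xi p) (tv p)) / gram (tu p) (tv p).
Definition coef_v xi j p := (mink (tu p) (tu p) * mink (partial j xi p) (tv p)
  - mink (tu p) (tv p) * mink (partial j xi p) (tu p)) / gram (tu p) (tv p).

Lemma derivable_mink f g i p : smooth_on D f -> smooth_on D g -> D p ->
  derivable (fun q => mink (f q) (g q)) p (delta_mx 0 i).
Proof.
move=> sf sg Dp.
by have [] := is_derive_mink (smooth_is_derive i sf Dp) (smooth_is_derive i sg Dp).
Qed.

Lemma derivable_gram_inv i p : D p ->
  derivable (fun q => (gram (tu q) (tv q))^-1) p (delta_mx 0 i).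
Proof.
move=> Dp; have dE := derivable_mink (i := i) tu_smooth tu_smooth Dp.
have dF := derivable_mink (i := i) tu_smooth tv_smooth Dp.
have dG := derivable_mink (i := i) tv_smooth tv_smooth Dp.
have dg : derivable (fun q => gram (tu q) (tv q)) p (delta_mx 0 i).
  exact: (derivableB (derivableM dE dG) (derivableM dF dF)).
by apply: derivableV dg; rewrite lt0r_neq0 // gram_gt0.
Qed.

Lemma derivable_coef xi i j p : smooth_on D xi -> D p ->
  derivable (coef_u xi j) p (delta_mx 0 i) /\
  derivable (coef_v xi j) p (delta_mx 0 i).
Proof.
move=> xi_s Dp; have dxi := smooth_partial j xi_s.
have dE := derivable_mink (i := i) tu_smooth tu_smooth Dp.
have dF := derivable_mink (i := i) tu_smooth tv_smooth Dp.
have dG := derivable_mink (i := i) tv_smooth tv_smooth Dp.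
have du := derivable_mink (i := i) dxi tu_smooth Dp.
have dv := derivable_mink (i := i) dxi tv_smooth Dp.
have dg := derivable_gram_inv (i := i) Dp.
split.
- exact: (derivableM (derivableB (derivableM dG du) (derivableM dF dv)) dg).
- exact: (derivableM (derivableB (derivableM dE dv) (derivableM dF du)) dg).
Qed.

(** The derivatives of the coefficients multiply [tu] and [tv], which are
    orthogonal to [n]: only the derivatives of [tu] and [tv] contribute. *)
Lemma mink_conn2 xi i j p n : smooth_on D xi -> D p ->
  normal_to (tu p) (tv p) n ->
  mink (conn i (conn j xi) p) n = mink (partial i (partial j xi) p) n
    - coef_u xi j p * mink (partial i tu p) n
    - coef_v xi j p * mink (partial i tv p) n.
Proof.
move=> xi_s Dp nn; have [dcu dcv] := derivable_coef i j xi_s Dp.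
have dxi := smooth_is_derive i (smooth_partial j xi_s) Dp.
have du := is_derive_scale (derivableP dcu) (smooth_is_derive i tu_smooth Dp).
have dv := is_derive_scale (derivableP dcv) (smooth_is_derive i tv_smooth Dp).
have dE : partial i (conn j xi) p = partial i (partial j xi) p
    - ('D_(delta_mx 0 i) (coef_u xi j) p *: tu p + coef_u xi j p *: partial i tu p)
    - ('D_(delta_mx 0 i) (coef_v xi j) p *: tv p + coef_v xi j p *: partial i tv p).
  by have [_ dE] := is_deriveB (is_deriveB dxi du) dv; exact: dE.
rewrite mink_normal_proj // dE.
move: (partial i _ p) (partial i _ p) (partial i _ p) => P Q S.
have [nu nv] := nn; rewrite !minkL !(minkC _ n) nu nv.
by ring.
Qed.

(** The second derivatives of [xi] cancel by symmetry; what remains are the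
    tangential coordinates of its first derivatives, and these are expressed by
    [xi] and the second derivatives of the surface. *)
Lemma ricci_equation xi p n :
  smooth_on D xi -> (forall q, D q -> normal_to (tu q) (tv q) (xi q)) -> D p ->
  normal_to (tu p) (tv p) n ->
  let wd X Y := mink X n * mink Y (xi p) - mink X (xi p) * mink Y n in
  mink (conn 0 (conn 1 xi) p - conn 1 (conn 0 xi) p) n * gram (tu p) (tv p) =
    mink (tv p) (tv p) * wd (partial 0 tu p) (partial 1 tu p)
  + mink (tu p) (tu p) * wd (partial 1 tu p) (partial 1 tv p)
  - mink (tu p) (tv p) * wd (partial 0 tu p) (partial 1 tv p).
Proof.
move=> xi_s xi_n Dp nn wd; have g0 : gram (tu p) (tv p) != 0.
  by rewrite lt0r_neq0 // gram_gt0.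
have xiu q : D q -> mink (xi q) (tu q) = 0 by case/xi_n.
have xiv q : D q -> mink (xi q) (tv q) = 0 by case/xi_n.
have := mink_partial_normal 0 xi_s tu_smooth xiu Dp.
have := mink_partial_normal 1 xi_s tu_smooth xiu Dp.
have := mink_partial_normal 0 xi_s tv_smooth xiv Dp.
have := mink_partial_normal 1 xi_s tv_smooth xiv Dp.
have := mink_conn2 0 1 xi_s Dp nn; have := mink_conn2 1 0 xi_s Dp nn.
rewrite /coef_u /coef_v (tuvC Dp) (partialC 0 1 D_open xi_s Dp) /wd.
(* From here on only the Minkowski products of the derivatives matter; they
   are replaced by variables. *)
move: (conn 0 _ p) (conn 1 _ p) (partial 1 (partial 0 xi) p) => C01 C10 Dxi.
move: (partial 0 xi p) (partial 1 xi p) => Xu Xv.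
move: (partial 0 tu p) (partial 1 tu p) (partial 1 tv p) => P Q S E10 E01.
move=> M1v M0v M1u M0u; rewrite minkDl minkNl E01 E10 M1v M0v M1u M0u.
rewrite ![mink (xi p) _]minkC.
by field.
Qed.

Context (n1 n2 : 'rV[R]_2 -> 'rV[R]_4).
Context (n1_smooth : smooth_on D n1).
Context (n1_normal : forall q, D q -> normal_to (tu q) (tv q) (n1 q))
  (n2_normal : forall q, D q -> normal_to (tu q) (tv q) (n2 q)).
Context (n_orthonormal : forall q, D q -> [/\ mink (n1 q) (n1 q) = 1,
  mink (n2 q) (n2 q) = -1 & mink (n1 q) (n2 q) = 0]).
Context (n_oriented : forall q, D q -> pos_oriented (tu q) (tv q) (n1 q) (n2 q)).

Let K p := wedge_trace (tu p) (tv p) (partial 0 tu p) (partial 1 tu p)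
  (partial 1 tv p) (n1 p) (n2 p).

(** For [n] a frame vector, [wd X Y] is minus [wedge X Y] times the product of
    [xi] with the other frame vector, whence the common factor [K p]. *)
Lemma ricci_frame xi p : smooth_on D xi ->
  (forall q, D q -> normal_to (tu q) (tv q) (xi q)) -> D p ->
  let C := conn 0 (conn 1 xi) p - conn 1 (conn 0 xi) p in
  mink C (n1 p) * gram (tu p) (tv p) = - (K p * mink (xi p) (n2 p)) /\
  mink C (n2 p) * gram (tu p) (tv p) = - (K p * mink (xi p) (n1 p)).
Proof.
move=> xi_s xi_n Dp C; have [n11 n22 n12] := n_orthonormal Dp.
have xiE := frame_expansion (n1_normal Dp) (n2_normal Dp) n11 n22 n12
  (n_oriented Dp) _ (xi_n p Dp).
rewrite /C !ricci_equation //; try exact: n1_normal; try exact: n2_normal.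
rewrite /K /wedge_trace /wedge.
move: (partial 0 tu p) (partial 1 tu p) (partial 1 tv p) => P Q S.
by rewrite ![mink _ (xi p)]minkC !(xiE P, xiE Q, xiE S); split; ring.
Qed.

(** Testing flatness on the section [n1] is enough to find [K]. *)
Lemma flat_iff_wedge_trace0 :
  (forall xi, smooth_on D xi ->
     (forall q, D q -> normal_to (tu q) (tv q) (xi q)) ->
   forall p, D p -> conn 0 (conn 1 xi) p - conn 1 (conn 0 xi) p = 0) <->
  (forall p, D p -> K p = 0).
Proof.
split=> [flat p Dp|K0 xi xi_s xi_n p Dp].
  have [_] := ricci_frame n1_smooth n1_normal Dp.
  have [-> _ _] := n_orthonormal Dp.
  by rewrite flat // mink0l mul0r mulr1 => /esym/eqP; rewrite oppr_eq0 => /eqP.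
have [] := ricci_frame xi_s xi_n Dp; rewrite K0 // !mul0r oppr0.
have g0 : gram (tu p) (tv p) != 0 by rewrite lt0r_neq0 // gram_gt0.
move=> /eqP; rewrite mulf_eq0 (negbTE g0) orbF => /eqP C1.
move=> /eqP; rewrite mulf_eq0 (negbTE g0) orbF => /eqP C2.
have [Cu Cv] : normal_to (tu p) (tv p)
    (conn 0 (conn 1 xi) p - conn 1 (conn 0 xi) p).
  have cn k xi' : normal_to (tu p) (tv p) (conn k xi' p).
    by apply: normal_projP; exact: gram_gt0.
  by apply: normal_toD; rewrite // -scaleN1r; exact: normal_toZ.
exact: mink_nondegenerate (n_oriented Dp) Cu Cv C1 C2.
Qed.

End RicciEquation.

(** * Spacelike surfaces *)

Section Surface.
Context {R : realType}.

Lemma spacelike_gram_gt0 (a b : 'rV[R]_4) :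
  (forall x : 'rV[R]_2, x != 0 -> 0 < first_form a b x x) ->
  0 < mink a a /\ 0 < gram a b.
Proof.
move=> pos; have E0 : 0 < mink a a.
  have -> : mink a a = first_form a b (row2 1 0) (row2 1 0).
    by rewrite first_formE !row2E; ring.
  by apply: pos; apply/eqP => /rowP/(_ 0)/eqP; rewrite row2E mxE oner_eq0.
split=> //; rewrite -(pmulr_rgt0 (gram a b) E0).
(* The vector (-F, E) is orthogonal to (1, 0) and has square E (E G - F^2). *)
have -> : mink a a * gram a b = first_form a b (row2 (- mink a b) (mink a a))
    (row2 (- mink a b) (mink a a)).
  by rewrite first_formE !row2E /gram; ring.
by apply: pos; apply/eqP => /rowP/(_ 1)/eqP; rewrite row2E mxE gt_eqF.
Qed.

Lemma sum_symmetric2 (x y : 'rV[R]_2) (d : 'I_2 -> 'I_2 -> 'rV[R]_4) :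
  d 0 1 = d 1 0 ->
  \sum_(i < 2) \sum_(j < 2) (x 0 i * y 0 j) *: d i j =
    (x 0 0 * y 0 0) *: d 0 0 + (x 0 0 * y 0 1 + x 0 1 * y 0 0) *: d 1 0
      + (x 0 1 * y 0 1) *: d 1 1.
Proof.
move=> dC; rewrite !big_ord_recl !big_ord0 !addr0.
have -> : lift ord0 ord0 = 1 :> 'I_2 by apply: val_inj.
by rewrite dC scalerDl !addrA.
Qed.

Lemma sigmaE (D : set 'rV[R]_2) (z : 'rV[R]_2 -> 'rV[R]_4) p x y :
  open D -> smooth_on D z -> D p ->
  sigma z p x y =
    second_form (zu z p) (zv z p) (zuu z p) (zuv z p) (zvv z p) x y.
Proof.
move=> oD sz Dp; have zC := partialC 0 1 oD sz Dp.
pose d i j := partial i (partial j z) p.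
by rewrite /sigma (@sum_symmetric2 x y d zC).
Qed.

End Surface.

Theorem proposition3p8 (R : realType) (D : set 'rV[R]_2)
    (z n1 n2 : 'rV[R]_2 -> 'rV[R]_4)
    (D_open : open D)
    (z_immersion : immersion_on z D)
    (z_spacelike : spacelike_on z D)
    (n_frame : normal_frame z D n1 n2)
    (no_flat_point : forall p, D p -> ~ flat_point z n1 n2 p) :
  flat_normal_connection z D <->
  (forall p, D p ->
     exists A B H : 'rV[R]_4,
       [/\ A != B,
           curvature_ellipse z p = line_segment A B,
           is_mean_curvature z p H &
           free [:: B - A; H]]).
Proof.
have [z_s _] := z_immersion; have [n1_s _ frameP] := n_frame.
have pos p (Dp : D p) := spacelike_gram_gt0 (z_spacelike p Dp).
have n1_n p : D p -> normal_to (zu z p) (zv z p) (n1 p) by case/frameP.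
have n2_n p : D p -> normal_to (zu z p) (zv z p) (n2 p) by case/frameP.
have n_on p : D p -> [/\ mink (n1 p) (n1 p) = 1,
  mink (n2 p) (n2 p) = -1 & mink (n1 p) (n2 p) = 0] by case/frameP.
have n_or p : D p -> pos_oriented (zu z p) (zv z p) (n1 p) (n2 p).
  by case/frameP.
have flatE := flat_iff_wedge_trace0 D_open (smooth_partial 0 z_s)
  (smooth_partial 1 z_s) (fun q Dq => (pos q Dq).2)
  (fun q Dq => partialC 0 1 D_open z_s Dq) n1_s n1_n n2_n n_on n_or.
have ellipseE p (Dp : D p) :
    wedge_trace (zu z p) (zv z p) (zuu z p) (zuv z p) (zvv z p) (n1 p) (n2 p) = 0
    <-> exists A B H : 'rV[R]_4,
       [/\ A != B, curvature_ellipse z p = line_segment A B,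
           is_mean_curvature z p H & free [:: B - A; H]].
  have [E0 g0] := pos p Dp.
  have not_flat : ~ [/\ wedge (n1 p) (n2 p) (zuu z p) (zuv z p) = 0,
      wedge (n1 p) (n2 p) (zuu z p) (zvv z p) = 0 &
      wedge (n1 p) (n2 p) (zuv z p) (zvv z p) = 0].
    move=> [D1 D2 D3]; apply: (no_flat_point p Dp).
    split.
    - by rewrite /fL (D1 : Delta1 z n1 n2 p = 0) mulr0 mul0r.
    - by rewrite /fM (D2 : Delta2 z n1 n2 p = 0) mul0r.
    - by rewrite /fN (D3 : Delta3 z n1 n2 p = 0) mulr0 mul0r.
  have := ellipse_segment_criterion E0 g0 (n1_n p Dp) (n2_n p Dp)
    (n_or p Dp) not_flat.
  have <- : sigma z p = second_form (zu z p) (zv z p) (zuu z p) (zuv z p) (zvv z p).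
    by apply/funext => x; apply/funext => y; exact: sigmaE D_open z_s Dp.
  exact.
split=> [flat p Dp|ell].
  apply/ellipseE => //; apply: (flatE.1 _ p Dp) => xi xi_s xi_n.
  exact: flat.
move=> xi [xi_s xi_n]; apply: (flatE.2 _ xi xi_s xi_n) => p Dp.
exact/ellipseE/ell.
Qed.
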